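(* Let $n\ge 1$, let $S$ be a subset of the variables generating $R_{I_n}$, and let $Z_S=\{z_{i_1},\dots,z_{i_k}\}$ be the set of variables $z_i$, $i\in[n+1]$, contained in $S$, where $i_1<\cdots<i_k$ and $k\geq 1$. For $\ell\in[n]$ write $S_\ell=S\cap\{y_{\ell\,\ell+1},y_{\ell+1\,\ell},z_{\ell\,\ell+1},t_{\ell\,\ell+1}\}$ and set $D_\ell^{\leftarrow}=\{y_{\ell+1\,\ell},z_{\ell\,\ell+1}\}$, $D_\ell^{\rightarrow}=\{y_{\ell\,\ell+1},z_{\ell\,\ell+1}\}$. Then $S$ is a facet of the triangulation of $\mathcal{C}_{I_n}$ corresponding to the lexicographic order described in the context if and only if all three of the following hold: (1) For every $1\le \ell\le i_1-1$, $S_\ell=D_\ell^{\leftarrow}$. (2) For every $j\in[k-1]$, one of the following holds: (2a) there is exactly one $m$ with $i_j<m\le i_{j+1}-1$ such that $S_m=\{t_{m\,m+1}\}$ or $S_m=\{y_{m+1\,m}\}$; moreover $S_\ell=D_\ell^{\leftarrow}$ for all $m<\ell\le i_{j+1}-1$, $S_{i_j}=D_{i_j}^{\rightarrow}$, and $S_\ell\in\{D_\ell^{\leftarrow},D_\ell^{\rightarrow}\}$ for all $i_j<\ell<m$; or (2b) $S_{i_j}=\{z_{i_j\,i_j+1}\}$ or $S_{i_j}=\{t_{i_j\,i_j+1}\}$, and $S_\ell=D_\ell^{\leftarrow}$ for all $i_j<\ell\le i_{j+1}-1$. (3) If $i_k<n+1$, then $S_{i_k}=D_{i_k}^{\rightarrow}$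 and $S_\ell\in\{D_\ell^{\leftarrow},D_\ell^{\rightarrow}\}$ for all $i_k<\ell\le n$.
   Context: $I_n$ is the path graph with vertex set $[n+1]=\{1,\dots,n+1\}$ and edge set $\{\ell\,\ell+1:\ell\in[n]\}$. For a graph $G=(V,E)$ with standard basis vectors $x_i,x_e$ of $\mathbb{R}^{|V|+|E|}$, the cosmological polytope is $\mathcal{C}_G=\mathrm{conv}\{x_i+x_j-x_e,\ x_i-x_j+x_e,\ -x_i+x_j+x_e: e=ij\in E\}$. $R_{I_n}$ is the polynomial ring over a field $K$ in the variables $z_i$ ($i\in[n+1]$) and, for each edge $e=\ell\,\ell+1$, the variables $z_{\ell\,\ell+1}=z_e$, $t_{\ell\,\ell+1}=t_e$, $y_{\ell\,\ell+1}$, $y_{\ell+1\,\ell}$. The variables correspond to the lattice points of $\mathcal{C}_{I_n}$: $z_i\leftrightarrow x_i$, $z_e\leftrightarrow x_e$, $y_{\ell\,\ell+1}\leftrightarrow x_\ell-x_{\ell+1}+x_e$, $y_{\ell+1\,\ell}\leftrightarrow -x_\ell+x_{\ell+1}+x_e$, $t_e\leftrightarrow x_\ell+x_{\ell+1}-x_e$. The toric ideal $I_{\mathcal{C}_{I_n}}$ is the kernel of the $K$-algebra map sending each variable to the Laurent monomial whose exponent vector is the corresponding lattice point. Consider the lexicographic term order on $R_{I_n}$ induced by the variable order $$y_{12}>y_{23}>\cdots>y_{n\,n+1}>y_{n+1\,n}>\cdots>y_{32}>y_{21}>z_{12}>\cdots>z_{n\,n+1}>t_{12}>\cdots>t_{n\,n+1}>z_1>\cdots>z_{n+1}.$$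 The initial ideal of $I_{\mathcal{C}_{I_n}}$ with respect to this order is squarefree, and it is the Stanley–Reisner ideal of a regular unimodular triangulation of $\mathcal{C}_{I_n}$: a set $S$ of variables is a face iff the product of the variables in $S$ does not lie in the initial ideal. Facets are the inclusion-maximal faces (they have $2n+1$ elements). *)

(* Defs.v *)
From HB Require Import structures.
From mathcomp Require Import all_boot all_order all_algebra.
From mathcomp.multinomials Require Import mpoly.

Set Implicit Arguments.
Unset Strict Implicit.
Unset Printing Implicit Defensive.

Import GRing.Theory.
Local Open Scope ring_scope.

(* Indices are 0-based: the vertex [i : 'I_n.+1] of the path I_n has label    *)
(* i + 1, and the edge [l : 'I_n] joins the vertices of indices l and l + 1   *)
(* (labels l + 1 and l + 2).                                                  *)

(* With v, w the end vertices of the edge l (in this order):                  *)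
(*   yf l = y_{v w},  yb l = y_{w v},  ze l = z_{v w},  te l = t_{v w},       *)
(* and zv i is the vertex variable z_i.                                       *)
Inductive var (n : nat) :=
  | yf of 'I_n
  | yb of 'I_n
  | ze of 'I_n
  | te of 'I_n
  | zv of 'I_n.+1.

Section VarFinite.
Variable n : nat.

Definition var_code (v : var n) :
    ('I_n + 'I_n + ('I_n + 'I_n) + 'I_n.+1)%type :=
  match v with
  | yf l => inl (inl (inl l))
  | yb l => inl (inl (inr l))
  | ze l => inl (inr (inl l))
  | te l => inl (inr (inr l))
  | zv i => inr i
  end.

Definition var_decode
    (s : ('I_n + 'I_n + ('I_n + 'I_n) + 'I_n.+1)%type) : var n :=
  match s with
  | inl (inl (inl l)) => yf l
  | inl (inl (inr l)) => yb l
  | inl (inr (inl l)) => ze l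
  | inl (inr (inr l)) => te l
  | inr i => zv i
  end.

Lemma var_codeK : cancel var_code var_decode.
Proof. by case. Qed.

HB.instance Definition _ := Finite.copy (var n) (can_type var_codeK).

End VarFinite.

(* R_{I_n}, the variable v being the one of index enum_rank v. *)
Notation pring K n := {mpoly K[#|{: var n}|]}.

Definition pvar (K : fieldType) n (v : var n) : pring K n := 'X_(enum_rank v).

Section ToricIdeal.
Variables (K : fieldType) (n : nat).

(* R^{|V|+|E|}: the first n.+1 coordinates are the vertices, then the edges. *)
Definition xv (i : 'I_n.+1) : 'rV[int]_(n.+1 + n) := delta_mx 0 (lshift n i).
Definition xe (l : 'I_n) : 'rV[int]_(n.+1 + n) := delta_mx 0 (rshift n.+1 l).

Definition src (l : 'I_n) : 'I_n.+1 := widen_ord (leqnSn n) l.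
Definition tgt (l : 'I_n) : 'I_n.+1 := lift ord0 l.

Definition lattice_point (v : var n) : 'rV[int]_(n.+1 + n) :=
  match v with
  | yf l => xv (src l) - xv (tgt l) + xe l
  | yb l => - xv (src l) + xv (tgt l) + xe l
  | ze l => xe l
  | te l => xv (src l) + xv (tgt l) - xe l
  | zv i => xv i
  end.

(* The Laurent polynomial ring is realised inside the field of rational       *)
(* functions in n.+1 + n variables; this does not affect the kernel.          *)
Local Notation ratfun := {fraction {mpoly K[n.+1 + n]}}.

Definition laurent_monomial (a : 'rV[int]_(n.+1 + n)) : ratfun :=
  \prod_(k < n.+1 + n) (tofrac ('X_k : {mpoly K[n.+1 + n]})) ^ (a 0 k).

Definition toric_map (p : pring K n) : ratfun :=
  mmap (@tofrac {mpoly K[n.+1 + n]} \o @mpolyC (n.+1 + n) K)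
       (fun x => laurent_monomial (lattice_point (enum_val x))) p.

Definition toric_ideal (p : pring K n) : Prop := toric_map p = 0.

End ToricIdeal.

(* Position of a variable in the decreasing list                              *)
(* y_{12} > ... > y_{n n+1} > y_{n+1 n} > ... > y_{21} > z_{12} > ...         *)
(* > z_{n n+1} > t_{12} > ... > t_{n n+1} > z_1 > ... > z_{n+1}:              *)
(* the smaller the position, the larger the variable. Edge variables z_{12}   *)
(* etc. are the ze's, and the last block z_1 > ... > z_{n+1} the zv's.        *)
Definition var_pos n (v : var n) : nat :=
  match v with
  | yf l => l
  | yb l => n + rev_ord l
  | ze l => 2 * n + l
  | te l => 3 * n + l
  | zv i => 4 * n + i
  end%N.

Definition lex_lt n (m1 m2 : 'X_{1..#|{: var n}|}) : Prop :=
  exists v : var n,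
    (m1 (enum_rank v) < m2 (enum_rank v))%N /\
    forall w : var n, (var_pos w < var_pos v)%N ->
      m1 (enum_rank w) = m2 (enum_rank w).

Definition lead_monomial (K : fieldType) n
    (p : pring K n) (m : 'X_{1..#|{: var n}|}) : Prop :=
  m \in msupp p /\
  forall m', m' \in msupp p -> m' != m -> lex_lt m' m.

Definition ideal_gen (R : comNzRingType) (G : R -> Prop) (p : R) : Prop :=
  exists s : seq (R * R),
    (forall x, x \in s -> G x.2) /\ p = \sum_(x <- s) x.1 * x.2.

Definition initial_ideal (K : fieldType) n
    (I : pring K n -> Prop) : pring K n -> Prop :=
  ideal_gen (fun q => exists p m,
    [/\ I p, lead_monomial p m & q = 'X_[m]]).

(* As the initial ideal is squarefree, it is the Stanley-Reisner ideal of the *)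
(* triangulation, so faces are the sets whose product lies outside of it.     *)
Definition is_face (K : fieldType) n (S : {set var n}) : Prop :=
  ~ initial_ideal (@toric_ideal K n) (\prod_(v in S) pvar K v).

Definition is_facet (K : fieldType) n (S : {set var n}) : Prop :=
  is_face K S /\ forall T : {set var n}, is_face K T -> S \subset T -> T = S.

Definition edge_block n (S : {set var n}) (l : 'I_n) : {set var n} :=
  S :&: [set yf l; yb l; ze l; te l].

Definition Dleft n (l : 'I_n) : {set var n} := [set yb l; ze l].
Definition Dright n (l : 'I_n) : {set var n} := [set yf l; ze l].

(* Main.v *)
Require Import Defs.
From HB Require Import structures.
From mathcomp Require Import all_boot all_order all_algebra.
From mathcomp.multinomials Require Import mpoly.
From mathcomp Require Import zify.

Set Implicit Arguments.
Unset Strict Implicit.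
Unset Printing Implicit Defensive.

Import GRing.Theory Num.Theory.

(** The triangulation is controlled by the fibers of the toric
    parametrization: a squarefree monomial lies outside the initial ideal iff
    it is the lexicographically smallest monomial with its exponent vector
    ([initial_ideal_monomialP], [is_faceP]).

    For an edge [e] from [v] to [w], write [y] for [y_{v w}] ([yf]) and [y']
    for [y_{w v}] ([yb]). Three families of binomials already cut out all the
    nonfaces ([admissible], [faceP]). The relations [y y' = z_e^2],
    [y t = z_v^2], [y' t = z_w^2] and [z_e t = z_v z_w] allow on each edge
    either [t] alone, or [z_e] with at most one of [y] and [y']. The relation
    [y' z_v = z_e z_w] forbids [y'] next to [z_v]. Finally a product of [y] on
    one edge, [z_e] on the following edges and the vertex variable [z_j] at
    their end is forbidden, because [z_j] can be moved back to the first edge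
    while [y] turns into [z_e] and each [z_e] into [y']. Conversely, an
    admissible set is the smallest of its fiber: the difference of two
    monomials of a fiber is a flow on the path, in which a loss of [y] would
    have to be propagated to the right ([no_yf_drop]), and a loss of [y'] to
    the left ([no_yb_drop]), until the path ends.

    A facet is then a maximal admissible set. What may occur on the edge [p]
    depends on its left end, on whether some [y] is visible from there
    ([yf_visible]), and on whether a vertex variable is visible from its right
    end ([zv_visible]). This leaves five kinds of edges ([cell]) and gives a
    local description of the facets ([is_facet_cellular]). Scanning the path
    from left to right, [yf_visible] is a two-state automaton: it is off at
    every [z_i], a pair [{y, z_e}] at [z_i] switches it on, pairs keep it on, a
    single [t] or [y'] switches it off, and while it is off only the pair
    [{y', z_e}] may occur until the next [z_i]. Cutting the path at the
    vertices [z_i] turns this into the three conditions. *)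

(** * Monomials of the initial ideal *)

Section InitialIdeal.
Variables (K : fieldType) (n : nat).
Local Open Scope ring_scope.

Local Notation mon := 'X_{1..#|{: var n}|}.
Local Notation vecs := 'rV[int]_(n.+1 + n).
Local Notation lmon := (@laurent_monomial K n).

Definition exponent (m : mon) : vecs :=
  \sum_(v : var n) lattice_point v *+ m (enum_rank v).

Lemma exponentD (m1 m2 : mon) :
  exponent (m1 + m2)%MM = exponent m1 + exponent m2.
Proof.
by rewrite -big_split; apply: eq_bigr => v _; rewrite mnmDE mulrnDr.
Qed.

Lemma laurent_monomialD (a b : vecs) : lmon (a + b) = lmon a * lmon b.
Proof.
rewrite /laurent_monomial -big_split; apply: eq_bigr => k _ /=.
by rewrite mxE expfzDr // tofrac_eq0 -msupp_eq0 msuppX.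
Qed.

Lemma laurent_monomial0 : lmon (0 : vecs) = 1.
Proof. by rewrite /laurent_monomial big1 // => k _; rewrite mxE. Qed.

Lemma laurent_monomialMn (a : vecs) j : lmon (a *+ j) = lmon a ^+ j.
Proof.
elim: j => [|j IH]; first by rewrite laurent_monomial0.
by rewrite mulrS exprS laurent_monomialD IH.
Qed.

Lemma laurent_monomial_nneg (a : vecs) : (forall k, 0 <= a 0 k) ->
  lmon a = tofrac 'X_[[multinom absz (a 0%R k) | k < n.+1 + n]].
Proof.
move=> a_ge0; rewrite mpolyXE_id rmorph_prod; apply: eq_bigr => k _ /=.
by rewrite mnmE rmorphXn /= -[in LHS](gez0_abs (a_ge0 k)).
Qed.

Lemma toric_mapE (p : pring K n) :
  toric_map p = \sum_(m <- msupp p) tofrac (p@_m)%:MP * lmon (exponent m).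
Proof.
apply: eq_bigr => m _; congr (_ * _).
rewrite /mmap1 /exponent (big_morph lmon laurent_monomialD laurent_monomial0).
rewrite (reindex (@enum_rank _)) /=; last exact/onW_bij/enum_rank_bij.
by apply: eq_bigr => v _; rewrite laurent_monomialMn enum_rankK.
Qed.

(** Multiplying by a common monomial makes all exponents nonnegative, which
    turns a relation between Laurent monomials into one between polynomials;
    there the coefficient of the monomial of [m] cannot cancel unless another
    monomial of [p] is sent to the same exponent vector. *)
Lemma toric_ideal_collision (p : pring K n) (m : mon) :
  toric_ideal p -> m \in msupp p ->
  exists m', [/\ m' \in msupp p, m' != m & exponent m' = exponent m].
Proof.
move=> p0 m_p.
have [/hasP[m' m'p /andP[ne /eqP eq]]|/hasPn no] :=
  boolP (has (fun m' => (m' != m) && (exponent m' == exponent m)) (msupp p)).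
  by exists m'.
pose N : vecs := \row_k \sum_(m' <- msupp p) `|exponent m' 0 k|.
have N_ge m' k : m' \in msupp p -> 0 <= (N + exponent m') 0 k.
  move=> m'p; rewrite !mxE (big_rem m') //=.
  set x := exponent m' 0 k; set s := \sum_(_ <- _) _.
  have s_ge0 : 0 <= s by apply: sumr_ge0 => *; rewrite normr_ge0.
  lia.
pose mu m' : 'X_{1.. n.+1 + n} :=
  [multinom absz ((N + exponent m')%R 0%R k) | k < _].
have : lmon N * toric_map p =
    tofrac (\sum_(m' <- msupp p) (p@_m')%:MP * 'X_[mu m'] : {mpoly K[_]}).
  rewrite toric_mapE mulr_sumr rmorph_sum /= !big_seq; apply: eq_bigr => m' m'p.
  rewrite mulrCA -laurent_monomialD laurent_monomial_nneg ?rmorphM // => k.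
  exact: N_ge.
rewrite p0 mulr0 => /esym/eqP; rewrite tofrac_eq0 => /eqP sum0.
have := congr1 (mcoeff (mu m)) sum0.
rewrite mcoeff0 raddf_sum /= (bigD1_seq m) //= mcoeffCM mcoeffX eqxx mulr1.
rewrite big_seq_cond big1 ?addr0 => [/eqP|m' /andP[m'p ne]].
  by rewrite mcoeff_eq0 m_p.
rewrite mcoeffCM mcoeffX; case: eqP => [eq|_]; last by rewrite mulr0.
case/negP: (no _ m'p); rewrite ne; apply/eqP/matrixP => i k; rewrite ord1.
have := congr1 (fun u : 'X_{1.. _} => u k) eq; rewrite !mnmE => eq_k.
move/(congr1 Posz): eq_k.
by rewrite !gez0_abs ?N_ge // ![(N + _)%R _ _]mxE => /addrI.
Qed.

Lemma lex_lt_addr (m1 m2 m : mon) :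
  lex_lt m1 m2 -> lex_lt (m1 + m)%MM (m2 + m)%MM.
Proof.
case=> v [lt_v eq_w]; exists v; rewrite !mnmDE ltn_add2r; split=> // w /eq_w.
by rewrite !mnmDE => ->.
Qed.

(** The toric ideal is graded by exponent vectors, hence spanned by binomials
    whose two terms have the same exponent vector; this is why only the fiber
    of [m] matters. *)
Lemma initial_ideal_monomialP (m : mon) :
  initial_ideal (@toric_ideal K n) 'X_[m] <->
  exists m', exponent m' = exponent m /\ lex_lt m' m.
Proof.
split=> [[s [s_lead eqX]]|[m' [eq_e lt_m]]]; last first.
  (* The binomial of [m] and [m'] lies in the toric ideal and is led by [m]. *)
  exists [:: (1, 'X_[m])]; split; last by rewrite big_seq1 mul1r.
  move=> x; rewrite inE => /eqP-> /=.
  have ne : m' != m.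
    by apply/eqP => eq; case: lt_m => v []; rewrite eq ltnn.
  exists ('X_[m] - 'X_[m']), m; split=> //.
    rewrite /toric_ideal /toric_map mmapB !mmapX -(mul1r (mmap1 _ m)).
    rewrite -(mul1r (mmap1 _ m')).
    have := toric_mapE 'X_[m]; have := toric_mapE 'X_[m'].
    rewrite !msuppX !big_seq1 !mcoeffX !eqxx eq_e => <-.
    by rewrite /toric_map !mmapX !mul1r => ->; rewrite subrr.
  split=> [|m'' /msuppB_le].
    by rewrite mcoeff_msupp mcoeffB !mcoeffX eqxx (negbTE ne) subr0 oner_eq0.
  by rewrite mem_cat !msuppX !inE => /orP[]/eqP-> //; rewrite eqxx.
have /hasP[x x_s nz] : has (fun x => (x.1 * x.2)@_m != 0) s.
  apply/negPn/negP => /hasPn no.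
  have := congr1 (mcoeff m) eqX; rewrite mcoeffX eqxx raddf_sum /=.
  rewrite big_seq big1 => [/eqP|x x_s]; first by rewrite oner_eq0.
  by apply/eqP; rewrite -[_ == 0]negbK; exact: no.
have [p [d [Ip [d_p d_max] eq_x]]] := s_lead _ x_s.
have [d' [d'_p ne eq_e]] := toric_ideal_collision Ip d_p.
move: nz; rewrite eq_x -mcoeff_msupp (perm_mem (msuppMX _ _)) => /mapP[u _ ->].
exists (d' + u)%MM; split; first by rewrite !exponentD eq_e.
exact/lex_lt_addr/d_max.
Qed.

End InitialIdeal.

(** * The equations of a fiber *)

(** Extending families by zero to all natural indices lets neighbouring edges
    and vertices be compared without side conditions at the ends of the path. *)
Definition ext k (f : 'I_k -> nat) (p : nat) : nat := oapp f 0%N (insub p).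

Lemma ext_ord k (f : 'I_k -> nat) (l : 'I_k) : ext f l = f l.
Proof. by rewrite /ext valK. Qed.

Lemma ext_out k (f : 'I_k -> nat) p : (k <= p)%N -> ext f p = 0%N.
Proof. by move=> le_p; rewrite /ext insubN // -leqNgt. Qed.

Lemma sum_delta_ext k (f : 'I_k -> nat) p :
  (\sum_(l < k) (p == l :> nat) * f l)%N = ext f p.
Proof.
have [lt_p|le_p] := ltnP p k; last first.
  rewrite ext_out // big1 // => l _; case: eqP => // eq_p.
  by move: le_p (ltn_ord l); rewrite eq_p leqNgt => /negPf->.
rewrite -[p]/(val (Ordinal lt_p)) ext_ord (bigD1 (Ordinal lt_p)) //= eqxx.
rewrite mul1n big1 ?addn0 // => l; rewrite -val_eqE /= eq_sym.
by move/negPf->.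
Qed.

Section FiberEquations.
Variable n : nat.
Local Open Scope ring_scope.
Local Notation mon := 'X_{1..#|{: var n}|}.

Lemma var_decodeK : cancel (@var_decode n) (@var_code n).
Proof. by case=> [[[]|[]]|]. Qed.

Lemma sum_var (F : var n -> int) :
  \sum_v F v = \sum_l F (yf l) + \sum_l F (yb l)
    + (\sum_l F (ze l) + \sum_l F (te l)) + \sum_i F (zv i).
Proof.
rewrite (reindex (@var_decode n)) /=; last first.
  by exists (@var_code n) => x _; [apply: var_decodeK | apply: var_codeK].
by rewrite !big_sumType.
Qed.

Definition exp_at k (c : 'I_k -> var n) (m : mon) (p : nat) : nat :=
  ext (fun l => m (enum_rank (c l))) p.

Definition exp_before k (c : 'I_k -> var n) (m : mon) (p : nat) : nat :=
  if p is q.+1 then exp_at c m q else 0%N.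

(** In each coordinate, at most two of the lattice points of one kind of
    variable are nonzero: those of an edge and of its left neighbour. *)
Lemma sum_entry k (c : 'I_k -> var n) (m : mon) j (p : nat) (s s' : int) :
  (forall l : 'I_k, lattice_point (c l) 0 j =
    s *+ (p == l :> nat) + s' *+ (p == l.+1)) ->
  \sum_l (lattice_point (c l) *+ m (enum_rank (c l))) 0 j =
  s * (exp_at c m p)%:Z + s' * (exp_before c m p)%:Z.
Proof.
move=> entry; have sumM (x : int) q : \sum_(l < k) x *+ (q == l :> nat)
    *+ m (enum_rank (c l)) = x * (exp_at c m q)%:Z.
  rewrite /exp_at -sum_delta_ext -[_%:Z]natz mulr_natr -sumrMnr.
  by apply: eq_bigr => l _; rewrite mulrnA.
under eq_bigr => l _ do rewrite mulmxnE entry mulrnDl.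
rewrite big_split /= sumM; congr (_ + _).
case: p {entry} => [|q]; last exact: sumM.
by rewrite mulr0 big1 // => l _; rewrite mulr0n mul0rn.
Qed.

Ltac entry_tac := let l' := fresh "l" in move=> l';
  rewrite ?mxE ?eq_lshift ?eq_rshift ?eq_lrshift ?eq_rlshift -?val_eqE /=
    ?lift0 ?(eq_sym (nat_of_ord l')) ?eqxx //=;
  rewrite ?andbF ?mulr0n ?mul0rn ?mulNrn ?oppr0 ?addr0 ?add0r ?oppr0 //.

Lemma exponent_edge (m : mon) (l : 'I_n) :
  exponent m 0 (rshift n.+1 l) =
  (exp_at (@yf n) m l + exp_at (@yb n) m l + exp_at (@ze n) m l)%:Z
  - (exp_at (@te n) m l)%:Z.
Proof.
rewrite /exponent summxE sum_var.
rewrite (@sum_entry _ (@yf n) m _ l 1 0); last by entry_tac.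
rewrite (@sum_entry _ (@yb n) m _ l 1 0); last by entry_tac.
rewrite (@sum_entry _ (@ze n) m _ l 1 0); last by entry_tac.
rewrite (@sum_entry _ (@te n) m _ l (-1) 0); last by entry_tac.
rewrite (@sum_entry _ (@zv n) m _ l 0 0); last by entry_tac.
lia.
Qed.

Lemma exponent_vertex (m : mon) (i : 'I_n.+1) :
  exponent m 0 (lshift n i) =
  (exp_at (@zv n) m i + exp_at (@yf n) m i + exp_at (@te n) m i
    + exp_before (@yb n) m i + exp_before (@te n) m i)%:Z
  - (exp_at (@yb n) m i + exp_before (@yf n) m i)%:Z.
Proof.
rewrite /exponent summxE sum_var.
rewrite (@sum_entry _ (@yf n) m _ i 1 (-1)); last by entry_tac.
rewrite (@sum_entry _ (@yb n) m _ i (-1) 1); last by entry_tac.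
rewrite (@sum_entry _ (@ze n) m _ i 0 0); last by entry_tac.
rewrite (@sum_entry _ (@te n) m _ i 1 1); last by entry_tac.
rewrite (@sum_entry _ (@zv n) m _ i 1 0); last by entry_tac.
lia.
Qed.

(** Equality of the two exponents of [x_e]; here and for the vertices the
    negative terms have been moved to the other side, so that the equations
    make sense over the natural numbers. *)
Definition edge_balance (a b : mon) (p : nat) : Prop :=
  (exp_at (@yf n) a p + exp_at (@yb n) a p + exp_at (@ze n) a p
     + exp_at (@te n) b p =
   exp_at (@yf n) b p + exp_at (@yb n) b p + exp_at (@ze n) b p
     + exp_at (@te n) a p)%N.

Definition vertex_balance (a b : mon) (p : nat) : Prop :=
  (exp_at (@zv n) a p + exp_at (@yf n) a p + exp_at (@te n) a p
     + exp_before (@yb n) a p + exp_before (@te n) a p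
     + (exp_at (@yb n) b p + exp_before (@yf n) b p) =
   exp_at (@zv n) b p + exp_at (@yf n) b p + exp_at (@te n) b p
     + exp_before (@yb n) b p + exp_before (@te n) b p
     + (exp_at (@yb n) a p + exp_before (@yf n) a p))%N.

Lemma exponent_eqP (a b : mon) :
  exponent a = exponent b <->
  (forall p, edge_balance a b p) /\ (forall p, vertex_balance a b p).
Proof.
split=> [eq_ab|[eqE eqV]].
  rewrite /edge_balance /vertex_balance; split=> p.
    have [lt_p|le_p] := ltnP p n; last by rewrite /exp_at !ext_out.
    have := exponent_edge b (Ordinal lt_p).
    by rewrite -eq_ab exponent_edge /=; lia.
  have [lt_p|le_p] := ltnP p n.+1.
    have := exponent_vertex b (Ordinal lt_p).
    by rewrite -eq_ab exponent_vertex /=; lia.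
  case: p le_p => // q le_q.
  by rewrite /exp_before /exp_at /= !ext_out //; lia.
apply/rowP => j; rewrite -[j]splitK.
case: (split j) => [i|l] /=.
  by rewrite !exponent_vertex; have := eqV i; rewrite /vertex_balance; lia.
by rewrite !exponent_edge; have := eqE l; rewrite /edge_balance; lia.
Qed.

End FiberEquations.

(** * Faces *)

Definition mem_at n k (c : 'I_k -> var n) (S : {set var n}) (p : nat) : bool :=
  oapp (fun l => c l \in S) false (insub p).

Local Notation yfm := (mem_at (@yf _)).
Local Notation ybm := (mem_at (@yb _)).
Local Notation zem := (mem_at (@ze _)).
Local Notation tem := (mem_at (@te _)).
Local Notation zvm := (mem_at (@zv _)).

Section Faces.
Variables (K : fieldType) (n : nat).
Local Notation mon := 'X_{1..#|{: var n}|}.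
Local Open Scope nat_scope.

Definition monomial_of (f : var n -> nat) : mon :=
  [multinom f (enum_val x) | x < #|{: var n}|].

Lemma monomial_ofE f v : monomial_of f (enum_rank v) = f v.
Proof. by rewrite mnmE enum_rankK. Qed.

Lemma mem_at_ord k (c : 'I_k -> var n) S (l : 'I_k) :
  mem_at c S l = (c l \in S).
Proof. by rewrite /mem_at valK. Qed.

Lemma mem_at_lt k (c : 'I_k -> var n) S p : mem_at c S p -> p < k.
Proof. by rewrite /mem_at; case: insubP. Qed.

Definition set_monomial (S : {set var n}) : mon :=
  monomial_of (fun v => v \in S : nat).

Lemma exp_at_set_monomial k (c : 'I_k -> var n) S p :
  exp_at c (set_monomial S) p = mem_at c S p.
Proof.
rewrite /exp_at /ext /mem_at; case: insub => //= l.
by rewrite monomial_ofE.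
Qed.

Lemma exp_before_set_monomial k (c : 'I_k -> var n) S p :
  exp_before c (set_monomial S) p.+1 = mem_at c S p.
Proof. exact: exp_at_set_monomial. Qed.

Lemma prod_pvarE (S : {set var n}) :
  (\prod_(v in S) pvar K v = 'X_[set_monomial S])%R.
Proof.
rewrite mpolyXE_id (reindex (@enum_rank _)) /=; last first.
  exact/onW_bij/enum_rank_bij.
rewrite big_mkcond; apply: eq_bigr => v _; rewrite monomial_ofE.
by case: (v \in S).
Qed.

Lemma is_faceP (S : {set var n}) :
  is_face K S <-> forall b : mon,
    exponent b = exponent (set_monomial S) -> ~ lex_lt b (set_monomial S).
Proof.
rewrite /is_face prod_pvarE; split=> [nI b eq_e lt_b|min_S].
  by apply: nI; apply/initial_ideal_monomialP; exists b.
by case/initial_ideal_monomialP => b [/min_S].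
Qed.

(** Sets containing none of the leading terms of the binomials
    [y y' - z_e^2], [y t - z_v^2], [y' t - z_w^2], [z_e t - z_v z_w],
    [y' z_v - z_e z_w], and
    [y_q * \prod_(q < m < j) ze_m * z_j - ze_q * \prod_(q < m < j) y'_m * z_q]
    for an edge [q] and a vertex [j] to the right of it. *)
Definition admissible (S : {set var n}) : Prop :=
  [/\ forall p, ~~ (yfm S p && ybm S p),
      forall p, ~~ (tem S p && [|| yfm S p, ybm S p | zem S p]),
      forall p, ~~ (ybm S p && zvm S p)
    & forall q j, q < j -> yfm S q -> (forall p, q < p < j -> zem S p) ->
        ~~ zvm S j].

Lemma exp_at_lt k (c : 'I_k -> var n) S (b : mon) (l : 'I_k) :
  b (enum_rank (c l)) < set_monomial S (enum_rank (c l)) ->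
  mem_at c S l /\ exp_at c b l = 0.
Proof.
rewrite monomial_ofE mem_at_ord /exp_at ext_ord.
by case: (c l \in S) => //; case: (b _).
Qed.

Lemma exp_at_eq k (c : 'I_k -> var n) S (b : mon) :
  (forall l, b (enum_rank (c l)) = set_monomial S (enum_rank (c l))) ->
  forall p, exp_at c b p = mem_at c S p.
Proof.
move=> eq_b p; rewrite -exp_at_set_monomial /exp_at /ext.
by case: (insub p) => //= l.
Qed.

(** The rank of the block of a variable in the variable order: all [y]
    come first, then all [y'], and so on. *)
Definition block (v : var n) : nat :=
  match v with yf _ => 0 | yb _ => 1 | ze _ => 2 | te _ => 3 | zv _ => 4 end.

Lemma block_pos (v w : var n) : block w < block v -> var_pos w < var_pos v.
Proof.
case: w => l; have := ltn_ord l; case: v => l'; have := ltn_ord l' => //=.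
all: lia.
Qed.

Section Minimality.
Variables (S : {set var n}) (b : mon).
Hypothesis adm_S : admissible S.
Hypothesis eq_e : exponent b = exponent (set_monomial S).

Lemma edge_balanceE p :
  exp_at (@yf n) b p + exp_at (@yb n) b p + exp_at (@ze n) b p + tem S p =
  yfm S p + ybm S p + zem S p + exp_at (@te n) b p.
Proof.
by have [/(_ p)+ _] := (exponent_eqP _ _).1 eq_e;
   rewrite /edge_balance !exp_at_set_monomial.
Qed.

Lemma vertex_balance0 :
  exp_at (@zv n) b 0 + exp_at (@yf n) b 0 + exp_at (@te n) b 0 + ybm S 0 =
  zvm S 0 + yfm S 0 + tem S 0 + exp_at (@yb n) b 0.
Proof.
have [_ /(_ 0)] := (exponent_eqP _ _).1 eq_e.
by rewrite /vertex_balance !exp_at_set_monomial /= !addn0.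
Qed.

Lemma vertex_balanceS p :
  exp_at (@zv n) b p.+1 + exp_at (@yf n) b p.+1 + exp_at (@te n) b p.+1
    + exp_at (@yb n) b p + exp_at (@te n) b p + (ybm S p.+1 + yfm S p) =
  zvm S p.+1 + yfm S p.+1 + tem S p.+1 + ybm S p + tem S p
    + (exp_at (@yb n) b p.+1 + exp_at (@yf n) b p).
Proof.
have [_ /(_ p.+1)] := (exponent_eqP _ _).1 eq_e.
by rewrite /vertex_balance !exp_before_set_monomial !exp_at_set_monomial.
Qed.

(** By the edge equation, a loss of [t] costs at least one other variable of
    the same edge, and none of them is there when [t] is. *)
Lemma te_no_drop p : tem S p <= exp_at (@te n) b p.
Proof.
by case: adm_S => _ /(_ p) noT _ _; have := edge_balanceE p; lia.
Qed.

(** Let [d] denote the change from [S] to [b]. The edge and vertex equations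
    combine to [dz_{p+1} + (2 dy_{p+1} + dze_{p+1}) + (2 dy'_p + dze_p) = 0].
    A loss of [y_l] makes the last parenthesis positive at [p = l]. Then
    [z_{p+1}] drops, which admissibility excludes, or one of [y] and [z_e]
    drops on the edge [p + 1]; hence it is there and prolongs the chain of
    [z_e] that starts at a [y]. The two parentheses of the same edge add up to
    [2 dt >= 0], so the last one is again positive at [p + 1], and the loss
    travels beyond the right end of the path. *)
Lemma no_yf_drop l : yfm S l -> exp_at (@yf n) b l <> 0.
Proof.
move=> yf_l b_l; have [noYY noT _ noC] := adm_S.
pose chain p :=
  exists q, [/\ q <= p, yfm S q & forall m, q < m <= p -> zem S m].
have grow d : chain (l + d) /\ 2 * ybm S (l + d) + zem S (l + d) <
    2 * exp_at (@yb n) b (l + d) + exp_at (@ze n) b (l + d).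
  elim: d => [|d [[q [le_q yf_q ze_q]] IH]].
    rewrite addn0; split.
      by exists l; split=> // m; lia.
    by have := edge_balanceE l; have := te_no_drop l; have := noYY l; lia.
  rewrite addnS; set p := l + d in le_q ze_q IH *.
  have no_z : ~~ zvm S p.+1.
    by apply: (noC q) => // m lt_m; apply: ze_q; lia.
  have [yz grow_p] : (yfm S p.+1 || zem S p.+1) /\
      2 * ybm S p.+1 + zem S p.+1 <
      2 * exp_at (@yb n) b p.+1 + exp_at (@ze n) b p.+1.
    have := vertex_balanceS p; have := edge_balanceE p.
    have := edge_balanceE p.+1; have := te_no_drop p; have := te_no_drop p.+1.
    by clear -IH no_z; lia.
  split=> {grow_p IH no_z}//.
  have [yf_p|no_yf] := boolP (yfm S p.+1).
    by exists p.+1; split=> // m; lia.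
  exists q; split=> // [|m]; first by lia.
  have [->|ne] := eqVneq m p.+1; first by lia.
  by move=> lt_m; apply: ze_q; lia.
have [[q [le_q yf_q ze_q]] _] := grow n.
have := mem_at_lt yf_q; have [lt_q|] := ltnP q (l + n); last by lia.
have /mem_at_lt : zem S (l + n) by apply: ze_q; lia.
lia.
Qed.

(** When no [y] changes, a loss of [y'_p] forces a gain of [z_e] on the edge
    [p], because [t] does not drop. As [z_p] is not there to compensate it, the
    vertex equation makes [y'_{p-1}] drop, and the loss travels to the left
    end. *)
Lemma no_yb_drop l : (forall p, exp_at (@yf n) b p = yfm S p) ->
  ybm S l -> exp_at (@yb n) b l <> 0.
Proof.
move=> eq_yf; have [_ _ noZ _] := adm_S.
elim: l => [|p IH] yb_p b_p.
  have := noZ 0; have := vertex_balance0; have := edge_balanceE 0.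
  have := te_no_drop 0; have := eq_yf 0; lia.
have [yb_p' b_p'] : ybm S p /\ exp_at (@yb n) b p = 0; last exact: IH.
have := noZ p.+1; have := vertex_balanceS p; have := edge_balanceE p.
have := edge_balanceE p.+1; have := te_no_drop p; have := te_no_drop p.+1.
have := eq_yf p; have := eq_yf p.+1; lia.
Qed.

Lemma admissible_minimal : ~ lex_lt b (set_monomial S).
Proof.
have [_ noT _ _] := adm_S.
case=> v []; case: v => l /exp_at_lt[in_l b_l] eq_w.
  exact: no_yf_drop b_l.
all: have eq_yf p : exp_at (@yf n) b p = yfm S p
  by move: p; apply: exp_at_eq => l'; exact/eq_w/block_pos.
  exact: no_yb_drop b_l.
all: have eq_yb p : exp_at (@yb n) b p = ybm S p
  by move: p; apply: exp_at_eq => l'; exact/eq_w/block_pos.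
  have := noT l; have := edge_balanceE l; have := eq_yf l; have := eq_yb l.
  lia.
all: have eq_ze p : exp_at (@ze n) b p = zem S p
  by move: p; apply: exp_at_eq => l'; exact/eq_w/block_pos.
  have := edge_balanceE l; have := eq_yf l; have := eq_yb l; have := eq_ze l.
  lia.
have eq_te p : exp_at (@te n) b p = tem S p
  by move: p; apply: exp_at_eq => l'; exact/eq_w/block_pos.
case: l in_l b_l {eq_w} => [[|p] lt_p] /= in_l b_l.
  have := vertex_balance0; have := eq_yf 0; have := eq_yb 0; have := eq_te 0.
  lia.
have := vertex_balanceS p; have := eq_yf p; have := eq_yb p; have := eq_te p.
have := eq_yf p.+1; have := eq_yb p.+1; have := eq_te p.+1; lia.
Qed.

End Minimality.

Lemma exponentU (v : var n) : exponent U_(enum_rank v) = lattice_point v.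
Proof.
rewrite /exponent (bigD1 v) //= mnm1E eqxx mulr1n big1 ?addr0 // => w ne.
by rewrite mnm1E (inj_eq enum_rank_inj) eq_sym (negPf ne) mulr0n.
Qed.

Lemma exponent_set_monomial (N : {set var n}) :
  exponent (set_monomial N) = (\sum_(v in N) lattice_point v)%R.
Proof.
rewrite [RHS]big_mkcond; apply: eq_bigr => v _.
by rewrite monomial_ofE; case: (v \in N); rewrite ?mulr1n ?mulr0n.
Qed.

(** All variables of [m] are smaller than [v]. *)
Definition below (v : var n) (m : mon) : Prop :=
  forall w, var_pos w <= var_pos v -> m (enum_rank w) = 0.

Lemma belowD v m1 m2 : below v m1 -> below v m2 -> below v (m1 + m2)%MM.
Proof. by move=> b1 b2 w le_w; rewrite mnmDE b1 ?b2. Qed.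

Lemma belowU v w : var_pos v < var_pos w -> below v U_(enum_rank w).
Proof.
move=> lt_v x le_x; rewrite mnm1E (inj_eq enum_rank_inj).
by case: eqP => // eq_w; move: lt_v; rewrite eq_w ltnNge le_x.
Qed.

(** A binomial led by the squarefree monomial of [v |: N], with [v] its
    largest variable, rules out this monomial in every face. *)
Lemma face_no_reduction S v (N : {set var n}) (m : mon) :
  is_face K S -> v \in S -> N \subset S ->
  (forall w, w \in N -> var_pos v < var_pos w) -> below v m ->
  exponent m <> (lattice_point v + \sum_(w in N) lattice_point w)%R.
Proof.
move=> /is_faceP min_S v_S sNS v_N v_m eq_e.
pose u := set_monomial (S :\: (v |: N)).
have vN : v \notin N by apply/negP => /v_N; rewrite ltnn.
have eqS : set_monomial S = (U_(enum_rank v) + set_monomial N + u)%MM.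
  apply/mnmP => x; rewrite -(enum_valK x); move: (enum_val x) => w.
  rewrite !mnmDE !monomial_ofE mnm1E (inj_eq enum_rank_inj) !inE eq_sym.
  have [->|_] := eqVneq w v; first by rewrite (negPf vN) v_S.
  by have := subsetP sNS w; case: (w \in N) => // ->.
apply: (min_S (m + u)%MM).
  by rewrite eqS !exponentD eq_e exponentU exponent_set_monomial.
rewrite eqS; apply: lex_lt_addr; exists v.
rewrite mnmDE monomial_ofE (negPf vN) mnm1E eqxx v_m //; split=> // w lt_w.
rewrite mnmDE monomial_ofE mnm1E (inj_eq enum_rank_inj) v_m ?(ltnW lt_w) //.
case: eqP => [eq_w|_]; first by move: lt_w; rewrite eq_w ltnn.
by case: (boolP (w \in N)) => // /v_N; rewrite ltnNge (ltnW lt_w).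
Qed.

Lemma mem_atP k (c : 'I_k -> var n) S p :
  mem_at c S p -> exists2 l : 'I_k, p = l & c l \in S.
Proof. by rewrite /mem_at; case: insubP => //= l _ <- in_l; exists l. Qed.

Lemma telescope_path (q : 'I_n) (j : 'I_n.+1) : q < j ->
  (\sum_(l < n | (q < l < j)%N) (xv (tgt l) - xv (src l)) =
   xv j - xv (tgt q))%R.
Proof.
move=> lt_qj; have le_jn : j <= n by have := ltn_ord j; lia.
pose X p : 'rV[int]_(n.+1 + n) := xv (inord p).
have xvE (i : 'I_n.+1) p : i = p :> nat -> xv i = X p.
  by move<-; rewrite /X inord_val.
rewrite (xvE j j) // (xvE (tgt q) q.+1) // -telescope_sumr //.
rewrite (@big_nat_widen _ _ _ _ _ n) // big_geq_mkord.
apply: eq_big => [l|l _]; first by rewrite andbC.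
by rewrite (xvE (tgt l) l.+1) ?(xvE (src l) l).
Qed.

(** The binomials listed for [admissible] satisfy the equations of a fiber. *)
Lemma face_admissible S : is_face K S -> admissible S.
Proof.
move=> face_S; have no := face_no_reduction face_S.
have no2 v w x y : v \in S -> w \in S ->
    block v < block w -> block v < block x -> block v < block y ->
    (lattice_point x + lattice_point y <> lattice_point v + lattice_point w)%R.
  move=> v_S w_S lt_w lt_x lt_y.
  have := @no v [set w] (U_(enum_rank x) + U_(enum_rank y))%MM v_S.
  rewrite exponentD !exponentU big_set1 sub1set; apply=> //.
    by move=> u /set1P->; apply: block_pos.
  by apply: belowD; apply: belowU; apply: block_pos.
split.
- move=> p; apply/negP => /andP[/mem_atP[l -> yf_l]].
  rewrite mem_at_ord => yb_l.
  apply: (no2 (yf l) (yb l) (ze l) (ze l)) => //=.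
  by apply/rowP => x; rewrite !mxE; lia.
- move=> p; apply/negP => /andP[/mem_atP[l -> te_l]].
  rewrite !mem_at_ord => /or3P[] e_l.
  + apply: (no2 (yf l) (te l) (zv (src l)) (zv (src l))) => //=.
    by apply/rowP => x; rewrite !mxE; lia.
  + apply: (no2 (yb l) (te l) (zv (tgt l)) (zv (tgt l))) => //=.
    by apply/rowP => x; rewrite !mxE; lia.
  + apply: (no2 (ze l) (te l) (zv (src l)) (zv (tgt l))) => //=.
    by apply/rowP => x; rewrite !mxE; lia.
- move=> p; apply/negP => /andP[/mem_atP[l -> yb_l]].
  rewrite -[nat_of_ord l]/(nat_of_ord (src l)) mem_at_ord => zv_l.
  apply: (no2 (yb l) (zv (src l)) (ze l) (zv (tgt l))) => //=.
  by apply/rowP => x; rewrite !mxE; lia.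
(* The two sides of the chain relation are [y_q] times [N], and [m]. *)
move=> q' j' + /mem_atP[q eq_q yf_q] ze_qj.
rewrite {q'}eq_q in ze_qj * => lt_qj; apply/negP => /mem_atP[j eq_j zv_j].
rewrite {j'}eq_j in lt_qj ze_qj.
pose N := zv j |: [set ze l | l : 'I_n & q < l < j].
pose m : mon := (U_(enum_rank (ze q)) + U_(enum_rank (zv (src q)))
  + \big[mnm_add/0%MM]_(l < n | q < l < j) U_(enum_rank (yb l)))%MM.
apply: (no (yf q) N m) => //.
- apply/subsetP => w /setU1P[->//|/imsetP[l]]; rewrite inE => lt_l ->.
  by rewrite -mem_at_ord; apply: ze_qj.
- by move=> w /setU1P[->|/imsetP[l _ ->]]; apply: block_pos.
- apply: belowD.
    by apply: belowD; apply: belowU; apply: block_pos.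
  apply: (big_ind (below (yf q))) => [w _|m1 m2|l _]; first exact: mnm0E.
    exact: belowD.
  exact/belowU/block_pos.
have exponent0 : exponent (0 : mon)%MM = 0%R.
  by rewrite /exponent big1 // => v _; rewrite mnm0E mulr0n.
rewrite big_setU1 /=; last by apply/imsetP => -[].
rewrite big_imset /=; last by move=> l1 l2 _ _ [].
rewrite (eq_bigl (fun l : 'I_n => q < l < j)) => [|l]; last by rewrite inE.
rewrite !exponentD !exponentU (big_morph _ (@exponentD n) exponent0).
rewrite (eq_bigr (fun l => xv (tgt l) - xv (src l) + xe l)%R); last first.
  by move=> l _; rewrite exponentU /= (addrC (- _)%R).
rewrite big_split /= telescope_path //.
by apply/rowP => x; rewrite !mxE; lia.
Qed.

Lemma faceP S : is_face K S <-> admissible S.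
Proof.
split=> [/face_admissible//|adm_S]; apply/is_faceP => b eq_e.
exact: admissible_minimal.
Qed.

End Faces.

(** * Facets as maximal admissible sets *)

Section Cells.
Variable n : nat.
Implicit Types S T : {set var n}.
Local Open Scope nat_scope.

(** Some [y] is visible from the vertex [p] when only edges carrying [z_e]
    lie in between; the recursion makes this a two-state automaton. *)
Fixpoint yf_visible S (p : nat) : bool :=
  if p is q.+1 then yfm S q || zem S q && yf_visible S q else false.

Definition zv_visible S (p : nat) : bool :=
  [exists j : 'I_n.+1, [&& p <= j, zv j \in S &
     [forall m : 'I_n, (p <= m < j) ==> (ze m \in S)]]].

Lemma yf_visibleP S p :
  reflect (exists2 q, q < p /\ yfm S q & forall m, q < m < p -> zem S m)
    (yf_visible S p).
Proof.
elim: p => [|p IH] /=; first by right => -[q []].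
apply: (iffP orP) => [[yf_p|/andP[ze_p /IH[q [lt_q yf_q] ze_q]]]|].
- by exists p => // m; lia.
- exists q => [|m lt_m]; first by split=> //; lia.
  by have [->//|ne] := eqVneq m p; apply: ze_q; lia.
case=> q [lt_q yf_q] ze_q; have [<-|ne] := eqVneq q p; first by left.
right; rewrite ze_q /=; last by lia.
by apply/IH; exists q => [|m lt_m]; [split=> //; lia | apply: ze_q; lia].
Qed.

Lemma zv_visibleP S p :
  reflect (exists2 j, p <= j /\ zvm S j & forall m, p <= m < j -> zem S m)
    (zv_visible S p).
Proof.
apply: (iffP existsP) => [[j /and3P[le_j zv_j /forallP ze_j]]|].
  exists (j : nat) => [|m lt_m]; first by rewrite mem_at_ord.
  have lt_mn : m < n by have := ltn_ord j; lia.
  have := ze_j (Ordinal lt_mn).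
  by rewrite lt_m /= -mem_at_ord.
case=> j' [le_j /mem_atP[j eq_j zv_j]] ze_j; rewrite {j'}eq_j in le_j ze_j.
exists j; rewrite le_j zv_j /=.
by apply/forallP => m; apply/implyP => /ze_j; rewrite mem_at_ord.
Qed.

Lemma admissibleP S :
  admissible S <->
  [/\ forall p, ~~ (yfm S p && ybm S p),
      forall p, ~~ (tem S p && [|| yfm S p, ybm S p | zem S p]),
      forall p, ~~ (ybm S p && zvm S p)
    & forall p, ~~ (yf_visible S p && zvm S p)].
Proof.
split=> -[yy te_only yb_zv yf_zv]; split=> //.
  move=> p; apply/negP => /andP[/yf_visibleP[q [lt_q yf_q] ze_q]].
  by apply/negP; apply: (yf_zv q).
move=> q j lt_q yf_q ze_q; have := yf_zv j.
by rewrite (_ : yf_visible S j) //; apply/yf_visibleP; exists q.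
Qed.

Lemma mem_at_subset k (c : 'I_k -> var n) S T p :
  S \subset T -> mem_at c S p -> mem_at c T p.
Proof. by move=> /subsetP sST /mem_atP[l -> /sST]; rewrite mem_at_ord. Qed.

Lemma admissible_subset S T : S \subset T -> admissible T -> admissible S.
Proof.
move=> sST [yy te_only yb_zv yf_zv].
have sub k c p := @mem_at_subset k c S T p sST.
split=> [p|p|p|q j lt_q yf_q ze_q].
- by apply: contra (yy p) => /andP[/sub-> /sub->].
- by apply: contra (te_only p) => /andP[/sub-> /or3P[] /sub->]; rewrite ?orbT.
- by apply: contra (yb_zv p) => /andP[/sub-> /sub->].
have /(yf_zv q j lt_q (sub _ _ _ yf_q)) : forall m, q < m < j -> zem T m.
  by move=> m /ze_q; apply: sub.
by apply: contra; apply: sub.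
Qed.

Lemma is_facet_maximal (K : fieldType) S :
  is_facet K S <->
  admissible S /\ forall v, v \notin S -> ~ admissible (v |: S).
Proof.
split=> -[face_S max_S]; split; try exact/(faceP K).
  move=> v vS /(@faceP K) face_vS.
  by move: vS; rewrite -(max_S _ face_vS (subsetUr _ _)) setU11.
move=> T /(faceP K) adm_T sST; apply/eqP; rewrite eqEsubset sST andbT.
apply/subsetP => v vT; apply/negPn/negP => /max_S; apply.
by apply: admissible_subset adm_T; rewrite subUset sub1set vT.
Qed.

Lemma mem_at_setU1 k (c : 'I_k -> var n) S l p :
  injective c -> mem_at c (c l |: S) p = (p == l) || mem_at c S p.
Proof.
move=> inj_c; rewrite /mem_at; case: insubP => [i _ <-|] /=.
  by rewrite in_setU1 (inj_eq inj_c).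
by case: eqP => // ->; rewrite ltn_ord.
Qed.

Lemma mem_at_setU1_ne k (c : 'I_k -> var n) S v p :
  (forall i, c i <> v) -> mem_at c (v |: S) p = mem_at c S p.
Proof.
move=> ne; rewrite /mem_at; case: insubP => [i _ _|//] /=.
by rewrite in_setU1; case: eqP => // /ne.
Qed.

Lemma yf_inj : injective (@yf n). Proof. by move=> ? ? []. Qed.
Lemma yb_inj : injective (@yb n). Proof. by move=> ? ? []. Qed.
Lemma ze_inj : injective (@ze n). Proof. by move=> ? ? []. Qed.
Lemma te_inj : injective (@te n). Proof. by move=> ? ? []. Qed.
Lemma zv_inj : injective (@zv n). Proof. by move=> ? ? []. Qed.

Definition edge_shape S p := (yfm S p, ybm S p, zem S p, tem S p).

Definition left_shape := (false, true, true, false).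
Definition right_shape := (true, false, true, false).
Definition te_shape := (false, false, false, true).
Definition yb_shape := (false, true, false, false).
Definition ze_shape := (false, false, true, false).

(** The possible contents of the edge [p] in a facet. The pair [{y', z_e}] is
    excluded by [z_p], and without [z_p] and visible [y] nothing else can block
    the addition of [z_p]. A visible [y] and a visible vertex variable leave no
    room for [z_e], which isolates [y']; and [z_e] is isolated where [z_p]
    blocks [y'] and a vertex variable to the right blocks [y]. *)
Inductive cell S p : Prop :=
  | cell_left of edge_shape S p = left_shape & ~~ zvm S p
  | cell_right of edge_shape S p = right_shape & zvm S p || yf_visible S p
  | cell_te of edge_shape S p = te_shape & zvm S p || yf_visible S p
  | cell_yb of edge_shape S p = yb_shape & yf_visible S p & zv_visible S p.+1
  | cell_ze of edge_shape S p = ze_shape & zvm S p & zv_visible S p.+1.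

Definition cellular S : Prop :=
  [/\ forall p, p < n -> cell S p,
      zvm S n || yf_visible S n
    & forall p, zvm S p -> ~~ yf_visible S p].

(** A variable outside a maximal admissible set is blocked by one of the
    forbidden products; the next five lemmas say by which ones. *)
Section Blocked.
Variable S : {set var n}.
Hypothesis adm_S : admissible S.
Hypothesis max_S : forall v, v \notin S -> ~ admissible (v |: S).

Lemma te_blocked (l : 'I_n) : ~~ tem S l -> [|| yfm S l, ybm S l | zem S l].
Proof.
move=> te_l; apply/negPn/negP => free; have [yy te_only yb_zv yf_zv] := adm_S.
apply: (max_S (v := te l)); first by rewrite -mem_at_ord.
split=> [p|p|p|q j]; rewrite ?(mem_at_setU1 _ _ _ te_inj) ?mem_at_setU1_ne //.
  by case: eqP => [->|_] //=; apply: te_only.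
move=> lt_q yf_q ze_q; apply: (yf_zv q) => // m /ze_q.
by rewrite mem_at_setU1_ne.
Qed.

Lemma yb_blocked (l : 'I_n) : ~~ ybm S l -> [|| yfm S l, tem S l | zvm S l].
Proof.
move=> yb_l; apply/negPn/negP => free; have [yy te_only yb_zv yf_zv] := adm_S.
apply: (max_S (v := yb l)); first by rewrite -mem_at_ord.
split=> [p|p|p|q j]; rewrite ?(mem_at_setU1 _ _ _ yb_inj) ?mem_at_setU1_ne //.
- by have := yy p; case: eqP => // ->; move: free; lia.
- by have := te_only p; case: eqP => // ->; move: free; lia.
- by have := yb_zv p; case: eqP => // ->; move: free; lia.
move=> lt_q yf_q ze_q; apply: (yf_zv q) => // m /ze_q.
by rewrite mem_at_setU1_ne.
Qed.

Lemma yf_blocked (l : 'I_n) :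
  ~~ yfm S l -> [|| ybm S l, tem S l | zv_visible S l.+1].
Proof.
move=> yf_l; apply/negPn/negP => free; have [yy te_only yb_zv yf_zv] := adm_S.
apply: (max_S (v := yf l)); first by rewrite -mem_at_ord.
split=> [p|p|p|q j]; rewrite ?(mem_at_setU1 _ _ _ yf_inj) ?mem_at_setU1_ne //.
- by have := yy p; case: eqP => // ->; move: free; lia.
- by have := te_only p; case: eqP => // ->; move: free; lia.
move=> lt_q /orP[/eqP eq_q|yf_q] ze_q; last first.
  by apply: (yf_zv q) => // m /ze_q; rewrite mem_at_setU1_ne.
apply: contra free => zv_j; apply/or3P/Or33/zv_visibleP.
by exists j => [|m]; rewrite -?eq_q // => /ze_q; rewrite mem_at_setU1_ne.
Qed.

Lemma ze_blocked (l : 'I_n) :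
  ~~ zem S l -> tem S l || yf_visible S l && zv_visible S l.+1.
Proof.
move=> ze_l; apply/negPn/negP => free; have [yy te_only yb_zv yf_zv] := adm_S.
apply: (max_S (v := ze l)); first by rewrite -mem_at_ord.
split=> [p|p|p|q j]; rewrite ?(mem_at_setU1 _ _ _ ze_inj) ?mem_at_setU1_ne //.
  by have := te_only p; case: eqP => // ->; move: free; lia.
move=> lt_q yf_q ze_q; have [/andP[lt_ql lt_lj]|out] := boolP (q < l < j).
  apply: contra free => zv_j; apply/orP; right; apply/andP; split.
    apply/yf_visibleP; exists q => // m lt_m.
    have := ze_q m; rewrite (mem_at_setU1 _ _ _ ze_inj).
    by case: eqP => [eq_m|_]; [lia | apply; lia].
  apply/zv_visibleP; exists j => // m lt_m.
  have := ze_q m; rewrite (mem_at_setU1 _ _ _ ze_inj).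
  by case: eqP => [eq_m|_]; [lia | apply; lia].
apply: (yf_zv q) => // m lt_m; have := ze_q m lt_m.
rewrite (mem_at_setU1 _ _ _ ze_inj) => /orP[/eqP eq_m|//].
by move: out; rewrite -eq_m lt_m.
Qed.

Lemma zv_blocked (i : 'I_n.+1) : ~~ zvm S i -> ybm S i || yf_visible S i.
Proof.
move=> zv_i; apply/negPn/negP => free; have [yy te_only yb_zv yf_zv] := adm_S.
apply: (max_S (v := zv i)); first by rewrite -mem_at_ord.
split=> [p|p|p|q j]; rewrite ?(mem_at_setU1 _ _ _ zv_inj) ?mem_at_setU1_ne //.
  by have := yb_zv p; case: eqP => // ->; move: free; lia.
move=> lt_q yf_q ze_q; have {}ze_q m : q < m < j -> zem S m.
  by move/ze_q; rewrite mem_at_setU1_ne.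
have := yf_zv q j lt_q yf_q ze_q; case: eqP => // eq_j _; move: free.
rewrite (_ : yf_visible S i) ?orbT //.
by apply/yf_visibleP; exists q; rewrite -?eq_j.
Qed.

Lemma maximal_cellular : cellular S.
Proof.
have [yy te_only yb_zv yf_zv] := (admissibleP S).1 adm_S.
split=> [p lt_p||p zv_p]; last by have := yf_zv p; rewrite zv_p andbT.
  have /implyP := @te_blocked (Ordinal lt_p).
  have /implyP := @yb_blocked (Ordinal lt_p).
  have /implyP := @yf_blocked (Ordinal lt_p).
  have /implyP := @ze_blocked (Ordinal lt_p).
  have /implyP := @zv_blocked (widen_ord (leqnSn n) (Ordinal lt_p)) => /=.
  have := yy p; have := te_only p; have := yb_zv p; have := yf_zv p.
  have : ~~ (yf_visible S p.+1 && zv_visible S p.+1).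
    apply/negP => /andP[/yf_visibleP[q [lt_q yf_q] ze_q]].
    case/zv_visibleP => j [lt_j zv_j] ze_j; have [_ _ _ noC] := adm_S.
    apply/negP: zv_j; apply: (noC q) => // [|m lt_m]; first by lia.
    by have [lt_mp|le_m] := ltnP m p.+1; [apply: ze_q | apply: ze_j]; lia.
  move: (@cell_left S p) (@cell_right S p) (@cell_te S p) (@cell_yb S p).
  move: (@cell_ze S p); rewrite /edge_shape /=.
  case: (yfm S p); case: (ybm S p); case: (zem S p); case: (tem S p);
  case: (zvm S p); case: (yf_visible S p); case: (zv_visible S p.+1) => //=;
  by auto using isT.
have := @zv_blocked ord_max; rewrite /=.
have -> : ybm S n = false by apply/negP => /mem_at_lt; rewrite ltnn.
by case: (zvm S n) => //= ->.
Qed.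

End Blocked.

Lemma cellular_admissible S : cellular S -> admissible S.
Proof.
case=> cells last_p vis; apply/admissibleP.
have no_out k (c : 'I_k -> var n) p : k <= p -> mem_at c S p = false.
  by move=> le_p; apply/negP => /mem_at_lt; lia.
split=> p; last by apply/negP => /andP[yf_p /vis]; rewrite yf_p.
all: have [/cells[]|le_p] := ltnP p n; last by rewrite !(no_out n).
all: rewrite /edge_shape => -[e1 e2 e3 e4]; rewrite ?e1 ?e2 ?e3 ?e4 //=.
by move=> yf_p _; apply/negP => /vis; rewrite yf_p.
Qed.

(** For every variable missing from a cell, what is present or visible there
    completes it to one of the forbidden products. *)
Lemma cellular_maximal S v : cellular S -> v \notin S -> ~ admissible (v |: S).
Proof.
move=> [cells last_p vis] vS [yy te_only yb_zv yf_zv].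
have sub k c p := @mem_at_subset k c S (v |: S) p (subsetUr _ _).
case: v => l in vS yy te_only yb_zv yf_zv sub *.
- have in_T := mem_at_setU1 S l l yf_inj; rewrite eqxx /= in in_T.
  have := yy l; have := te_only l; have := sub _ (@yb n) l.
  have := sub _ (@te n) l; move: vS; rewrite in_T -mem_at_ord.
  have [] := cells l (ltn_ord l) => -[e1 e2 e3 e4].
  all: rewrite ?e1 ?e2 ?e3 ?e4; try by clear; lia.
  move=> _ /zv_visibleP[j [lt_j zv_j] ze_j] _ _ _ _ _.
  have /(yf_zv l j lt_j) : forall m, l < m < j -> zem (yf l |: S) m.
    by move=> m /ze_j /sub.
  by rewrite in_T (sub _ _ _ zv_j) => /(_ isT).
- have in_T := mem_at_setU1 S l l yb_inj; rewrite eqxx /= in in_T.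
  have := yy l; have := te_only l; have := yb_zv l; have := sub _ (@yf n) l.
  have := sub _ (@te n) l; have := sub _ (@zv n) l.
  move: vS; rewrite in_T -mem_at_ord.
  by have [] := cells l (ltn_ord l) => -[e1 e2 e3 e4];
    rewrite ?e1 ?e2 ?e3 ?e4; clear; lia.
- have in_T := mem_at_setU1 S l l ze_inj; rewrite eqxx /= in in_T.
  have := te_only l; have := sub _ (@te n) l; move: vS.
  rewrite in_T -mem_at_ord.
  have [] := cells l (ltn_ord l) => -[_ _ e3 e4].
  all: rewrite ?e3 ?e4; try by clear; lia.
  case/yf_visibleP => q [lt_q yf_q] ze_q /zv_visibleP[j [lt_j zv_j] ze_j] _ _ _.
  suff /(yf_zv q j (ltn_trans lt_q lt_j) (sub _ _ _ yf_q)) :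
    forall m, q < m < j -> zem (ze l |: S) m by rewrite (sub _ _ _ zv_j).
  move=> m lt_m; rewrite (mem_at_setU1 _ _ _ ze_inj).
  case: (ltngtP m l) => [lt_ml|lt_lm|//] /=.
    by apply: ze_q; rewrite lt_ml; case/andP: lt_m => ->.
  by apply: ze_j; rewrite lt_lm; case/andP: lt_m => _ ->.
- have in_T := mem_at_setU1 S l l te_inj; rewrite eqxx /= in in_T.
  have := te_only l; have := sub _ (@yf n) l; have := sub _ (@yb n) l.
  have := sub _ (@ze n) l; move: vS; rewrite in_T -mem_at_ord.
  by have [] := cells l (ltn_ord l) => -[e1 e2 e3 e4];
    rewrite ?e1 ?e2 ?e3 ?e4; clear; lia.
have : ybm S l || yf_visible S l.
  move: vS; rewrite -mem_at_ord => /negPf no_zv.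
  have [lt_l|le_l] := ltnP l n; last first.
    have eq_l : l = n :> nat by apply/anti_leq; rewrite le_l -ltnS ltn_ord.
    rewrite eq_l in no_zv *.
    by move: last_p; rewrite no_zv /= => ->; rewrite orbT.
  by have [] := cells l lt_l; rewrite /edge_shape ?no_zv => -[_ -> _ _] //= ->.
case/orP => [yb_l|/yf_visibleP[q [lt_q yf_q] ze_q]].
  have := yb_zv l; rewrite (mem_at_setU1 _ _ _ zv_inj) eqxx.
  by rewrite (sub _ _ _ yb_l).
have /(yf_zv q l lt_q (sub _ _ _ yf_q)) :
    forall m, q < m < l -> zem (zv l |: S) m.
  by move=> m /ze_q /sub.
by rewrite (mem_at_setU1 _ _ _ zv_inj) eqxx.
Qed.

Theorem is_facet_cellular (K : fieldType) S : is_facet K S <-> cellular S.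
Proof.
rewrite is_facet_maximal; split=> [[adm_S max_S]|cell_S].
  exact: maximal_cellular.
split; first exact: cellular_admissible.
by move=> v; apply: cellular_maximal.
Qed.

End Cells.

(** * Facets in terms of the vertex variables *)

Section EdgeBlocks.
Variables (n : nat) (S : {set var n}).

Lemma edge_block_shape (A : {set var n}) (l : 'I_n) :
  A \subset [set yf l; yb l; ze l; te l] ->
  edge_block S l = A <->
  edge_shape S l = (yf l \in A, yb l \in A, ze l \in A, te l \in A).
Proof.
move=> sA; rewrite /edge_shape !mem_at_ord; split=> [<-|[e1 e2 e3 e4]].
  by rewrite /edge_block !inE !eqxx ?orbT !andbT.
apply/setP => v; rewrite /edge_block in_setI.
have [|vB] := boolP (v \in [set yf l; yb l; ze l; te l]); last first.
  by rewrite andbF; apply/esym/negbTE; apply: contra vB; apply: subsetP.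
by rewrite andbT !inE -!orbA => /or4P[] /eqP->.
Qed.

Lemma left_shapeP l : edge_block S l = Dleft l <-> edge_shape S l = left_shape.
Proof.
rewrite edge_block_shape ?inE ?eqxx //.
by apply/subsetP => v; rewrite !inE => /orP[] /eqP->; rewrite ?eqxx ?orbT.
Qed.

Lemma right_shapeP l :
  edge_block S l = Dright l <-> edge_shape S l = right_shape.
Proof.
rewrite edge_block_shape ?inE ?eqxx //.
by apply/subsetP => v; rewrite !inE => /orP[] /eqP->; rewrite ?eqxx ?orbT.
Qed.

Lemma te_shapeP l : edge_block S l = [set te l] <-> edge_shape S l = te_shape.
Proof. by rewrite edge_block_shape ?inE ?sub1set ?inE ?eqxx ?orbT. Qed.

Lemma yb_shapeP l : edge_block S l = [set yb l] <-> edge_shape S l = yb_shape.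
Proof. by rewrite edge_block_shape ?inE ?sub1set ?inE ?eqxx ?orbT. Qed.

Lemma ze_shapeP l : edge_block S l = [set ze l] <-> edge_shape S l = ze_shape.
Proof. by rewrite edge_block_shape ?inE ?sub1set ?inE ?eqxx ?orbT. Qed.

End EdgeBlocks.

Arguments yf_visible : simpl never.

Section Runs.
Variables (n : nat) (S : {set var n}).
Local Open Scope nat_scope.

Lemma yf_visible_shape p : yf_visible S p.+1 =
  let: (y, _, z, _) := edge_shape S p in y || z && yf_visible S p.
Proof. by []. Qed.

Lemma left_run_invisible p r : ~~ yf_visible S p ->
  (forall l, p <= l < r -> edge_shape S l = left_shape) ->
  forall l, p <= l <= r -> ~~ yf_visible S l.
Proof.
move=> yf_p left_l; elim=> [|l IH] le_l; first by case: p yf_p {left_l} le_l.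
have [eq_p|ne] := eqVneq p l.+1; first by rewrite -eq_p.
by rewrite yf_visible_shape left_l /= ?IH; lia.
Qed.

Lemma left_run_visible p r : p <= r -> zvm S r ->
  (forall l, p <= l < r -> edge_shape S l = left_shape) -> zv_visible S p.
Proof.
move=> le_p zv_r left_l; apply/zv_visibleP; exists r => // m /left_l.
by case=> _ _ ->.
Qed.

Lemma left_right_run_visible p r : yf_visible S p ->
  (forall l, p <= l < r ->
     edge_shape S l = left_shape \/ edge_shape S l = right_shape) ->
  forall l, p <= l <= r -> yf_visible S l.
Proof.
move=> yf_p lr_l; elim=> [|l IH] le_l; first by case: p yf_p {lr_l} le_l.
have [eq_p|ne] := eqVneq p l.+1; first by rewrite -eq_p.
have yf_l : yf_visible S l by apply: IH; lia.
have lt_l : p <= l < r by lia.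
by rewrite yf_visible_shape yf_l; case: (lr_l l lt_l) => ->.
Qed.

Hypothesis cell_S : cellular S.

Lemma cell_at_zv p : p < n -> zvm S p ->
  [/\ ~~ yf_visible S p & [\/ edge_shape S p = right_shape,
    edge_shape S p = ze_shape | edge_shape S p = te_shape]].
Proof.
case: cell_S => cells _ vis lt_p zv_p; have no_yf := vis _ zv_p; split=> //.
have [] := cells _ lt_p; rewrite ?zv_p ?(negPf no_yf) //.
- by constructor 1.
- by constructor 3.
by constructor 2.
Qed.

Lemma cell_invisible p : p < n -> ~~ zvm S p -> ~~ yf_visible S p ->
  edge_shape S p = left_shape.
Proof.
case: cell_S => cells _ _ lt_p /negPf no_zv /negPf no_yf.
by have [] := cells _ lt_p; rewrite ?no_zv ?no_yf.
Qed.

Lemma cell_visible p : p < n -> ~~ zvm S p -> yf_visible S p ->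
  if yf_visible S p.+1
  then edge_shape S p = left_shape \/ edge_shape S p = right_shape
  else edge_shape S p = te_shape \/ edge_shape S p = yb_shape.
Proof.
case: cell_S => cells _ _ lt_p /negPf no_zv yf_p; rewrite yf_visible_shape.
have [] := cells _ lt_p; rewrite ?no_zv // => ->; rewrite ?yf_p /=.
all: by auto.
Qed.

(** Once no [y] is visible, a facet continues with left pairs up to
    the next vertex variable. *)
Lemma invisible_run p r : r <= n -> ~~ yf_visible S p ->
  (forall l, p <= l < r -> ~~ zvm S l) ->
  (forall l, p <= l <= r -> ~~ yf_visible S l) /\
  (forall l, p <= l < r -> edge_shape S l = left_shape).
Proof.
move=> le_r yf_p no_zv.
have inv l : p <= l <= r -> ~~ yf_visible S l.
  elim: l => [|l IH] le_l; first by case: p yf_p {no_zv} le_l.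
  have [eq_p|ne] := eqVneq p l.+1; first by rewrite -eq_p.
  have lt_l : p <= l < r by lia.
  have yf_l : ~~ yf_visible S l by apply: IH; lia.
  by rewrite yf_visible_shape cell_invisible ?no_zv //; lia.
split=> // l lt_l.
by apply: cell_invisible; [lia | apply: no_zv | apply: inv; lia].
Qed.

End Runs.

Section Enumeration.
Variables (n : nat) (S : {set var n}) (k : nat) (i : 'I_k -> 'I_n.+1).
Hypothesis i_incr : forall a b : 'I_k, (a < b)%N -> (i a < i b)%N.
Hypothesis i_Z : forall v : 'I_n.+1, zv v \in S <-> exists a : 'I_k, i a = v.
Local Open Scope nat_scope.

Lemma zvm_i a : zvm S (i a).
Proof. by rewrite mem_at_ord; apply/i_Z; exists a. Qed.

Lemma zvmP p : zvm S p -> exists a, p = i a.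
Proof. by case/mem_atP => v -> /i_Z[a <-]; exists a. Qed.

Lemma i_le (a b : 'I_k) : a <= b -> i a <= i b.
Proof.
by rewrite leq_eqVlt => /orP[/eqP/val_inj->//|/i_incr/ltnW].
Qed.

Lemma no_zv_before (a : 'I_k) p : a = 0 :> nat -> p < i a -> ~~ zvm S p.
Proof.
move=> a0 lt_p; apply/negP => /zvmP[c eq_p].
by have := @i_le a c; rewrite a0; lia.
Qed.

Lemma no_zv_between (a b : 'I_k) p :
  b = a.+1 :> nat -> i a < p < i b -> ~~ zvm S p.
Proof.
move=> eq_b lt_p; apply/negP => /zvmP[c eq_p].
have [le_c|lt_c] := leqP c a; first by have := i_le le_c; lia.
by have := @i_le b c; rewrite eq_b; lia.
Qed.

Lemma no_zv_after (a : 'I_k) p : a.+1 = k -> i a < p -> ~~ zvm S p.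
Proof.
move=> eq_k lt_p; apply/negP => /zvmP[c eq_p].
by have := @i_le c a; have := ltn_ord c; lia.
Qed.

Lemma segment (hk : 0 < k) p :
  p < i (Ordinal hk) \/
  exists2 a, i a <= p & a.+1 = k \/ exists2 b : 'I_k, b = a.+1 :> nat & p < i b.
Proof.
have [lt_p|le_p] := ltnP p (i (Ordinal hk)); [by left | right].
have [a le_a max_a] := @arg_maxnP _ (Ordinal hk) (fun a => i a <= p) val le_p.
exists a => //; have [lt_a|le_k] := ltnP a.+1 k; last first.
  by left; apply/anti_leq; rewrite ltn_ord.
right; exists (Ordinal lt_a) => //; rewrite ltnNge; apply/negP => /max_a /=.
by rewrite ltnn.
Qed.

End Enumeration.

(* i_1 < ... < i_k is the increasing map [i : 'I_k -> 'I_n.+1]; its values    *)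
(* are 0-based vertex indices and the edge l joins the vertices l and l + 1.  *)
Theorem theorem3p2 (K : fieldType) (n : nat) (hn : (1 <= n)%N)
    (S : {set var n}) (k : nat) (hk : (1 <= k)%N) (i : 'I_k -> 'I_n.+1)
    (i_incr : forall a b : 'I_k, (a < b)%N -> (i a < i b)%N)
    (i_Z : forall v : 'I_n.+1, zv v \in S <-> exists a : 'I_k, i a = v) :
  is_facet K S <->
  [/\ (* (1) *)
      forall a : 'I_k, a = 0 :> nat ->
        forall l : 'I_n, (l < i a)%N -> edge_block S l = Dleft l,
      (* (2) *)
      forall a b : 'I_k, b = a.+1 :> nat ->
        (exists m : 'I_n,
          [/\ unique (fun m' : 'I_n =>
                (i a < m' < i b)%N /\
                (edge_block S m' = [set te m'] \/
                 edge_block S m' = [set yb m'])) m,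
              forall l : 'I_n, (m < l < i b)%N -> edge_block S l = Dleft l,
              forall l : 'I_n, l = i a :> nat -> edge_block S l = Dright l &
              forall l : 'I_n, (i a < l < m)%N ->
                edge_block S l = Dleft l \/ edge_block S l = Dright l])
        \/
        ((forall l : 'I_n, l = i a :> nat ->
            edge_block S l = [set ze l] \/ edge_block S l = [set te l]) /\
         (forall l : 'I_n, (i a < l < i b)%N -> edge_block S l = Dleft l))
    & (* (3) *)
      forall a : 'I_k, a.+1 = k -> (i a < n)%N ->
        (forall l : 'I_n, l = i a :> nat -> edge_block S l = Dright l) /\
        (forall l : 'I_n, (i a < l)%N ->
            edge_block S l = Dleft l \/ edge_block S l = Dright l)].
Proof.
rewrite is_facet_cellular; split=> [cell_S|[cond1 cond2 cond3]].
  have [cells last_n vis] := cell_S; split.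
  - move=> a a0 l lt_l; apply/left_shapeP.
    have [] // := @invisible_run _ _ cell_S 0 (i a).
    + by have := ltn_ord (i a).
    + by move=> p lt_p; apply: (no_zv_before i_incr i_Z a0).
    by move=> _; apply.
  - move=> a b eq_b; have lt_ab : (i a < i b)%N by apply: i_incr; rewrite eq_b.
    have lt_an : (i a < n)%N by have := ltn_ord (i b); lia.
    have no_zv p : (i a < p < i b)%N -> ~~ zvm S p.
      exact: (no_zv_between i_incr i_Z eq_b).
    have [yf_a shape_a] := cell_at_zv cell_S lt_an (zvm_i i_Z a).
    have tail p : (i a < p <= i b)%N -> ~~ yf_visible S p ->
        forall l : 'I_n, (p <= l < i b)%N -> edge_block S l = Dleft l.
      move=> lt_p yf_p l lt_l; apply/left_shapeP.
      have [] // := @invisible_run _ _ cell_S p (i b).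
      + by have := ltn_ord (i b).
      + by move=> q lt_q; apply: no_zv; lia.
      by move=> _; apply.
    have at_a l : l = i a :> nat -> edge_shape S l = edge_shape S (i a).
      by move->.
    have yf_a' := yf_visible_shape S (i a).
    (* The three possible contents of the edge leaving [z_{i_j}]: only a right
       pair makes some [y] visible, and leads to the first alternative. *)
    case: shape_a => shape_a; rewrite shape_a /= ?(negPf yf_a) in at_a yf_a'.
    + (* [p = m + 1] is the first later vertex from which no [y] is visible. *)
      left; have ex_p : exists p, (i a < p)%N && ~~ yf_visible S p.
        by exists (i b); rewrite lt_ab vis ?(zvm_i i_Z).
      case: (ex_minnP ex_p) => p /andP[lt_p yf_p] min_p.
      have le_pb : (p <= i b)%N by apply: min_p; rewrite lt_ab vis ?(zvm_i i_Z).
      have visible q : (i a < q < p)%N -> yf_visible S q.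
        move=> /andP[lt_aq lt_qp]; apply/negPn/negP => yf_q.
        have := min_p q; rewrite lt_aq yf_q => /(_ isT).
        by rewrite leqNgt lt_qp.
      have ne_p : p != (i a).+1 by apply: contraNneq yf_p => ->; rewrite yf_a'.
      case: p => // m in lt_p yf_p min_p le_pb visible ne_p *.
      have lt_m : (i a < m < i b)%N by lia.
      have lt_mn : (m < n)%N by have := ltn_ord (i b); lia.
      have yf_m : yf_visible S m by apply: visible; lia.
      have := cell_visible cell_S lt_mn (no_zv m lt_m) yf_m.
      rewrite (negPf yf_p) => shape_m.
      have lr (l : 'I_n) : (i a < l < m)%N ->
          edge_shape S l = left_shape \/ edge_shape S l = right_shape.
        move=> lt_l; have no_l : ~~ zvm S l by apply: no_zv; lia.
        have yf_l : yf_visible S l by apply: visible; lia.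
        have := cell_visible cell_S (ltn_ord l) no_l yf_l.
        by rewrite visible; last by lia.
      have tail_m := tail m.+1 _ yf_p.
      exists (Ordinal lt_mn); split=> /=.
      * split.
          split=> //; case: shape_m => shape_m; [left|right].
            exact/te_shapeP.
          exact/yb_shapeP.
        move=> l [lt_l block_l]; apply/val_inj => /=.
        have {}block_l : edge_shape S l = te_shape \/ edge_shape S l = yb_shape.
          by case: block_l => [/te_shapeP|/yb_shapeP]; auto.
        have [lt_lm|lt_ml|//] := ltngtP l m.
          have [] := lr l; first by lia.
            by case: block_l => ->.
          by case: block_l => ->.
        have /left_shapeP : edge_block S l = Dleft l by apply: tail_m; lia.
        by case: block_l => ->.
      * by move=> l lt_l; apply: tail_m; lia.
      * by move=> l /at_a eq_l; apply/right_shapeP.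
      by move=> l /lr[/left_shapeP|/right_shapeP]; auto.
    + right; split=> [l /at_a eq_l|l lt_l]; first by left; apply/ze_shapeP.
      by apply: (tail (i a).+1); rewrite ?yf_a' //; lia.
    right; split=> [l /at_a eq_l|l lt_l]; first by right; apply/te_shapeP.
    by apply: (tail (i a).+1); rewrite ?yf_a' //; lia.
  - move=> a eq_k lt_an.
    have [yf_a shape_a] := cell_at_zv cell_S lt_an (zvm_i i_Z a).
    have no_zv p : (i a < p)%N -> ~~ zvm S p by apply: (no_zv_after i_incr i_Z).
    have visible p : (i a < p <= n)%N -> yf_visible S p.
      move=> lt_p; apply/negPn/negP => yf_p.
      have [] := @invisible_run _ _ cell_S p n (leqnn n) yf_p.
        by move=> q lt_q; apply: no_zv; lia.
      move=> inv _; move: last_n.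
      by rewrite (negPf (no_zv n lt_an)) (negPf (inv n _)) //; lia.
    split=> [l eq_l|l lt_l].
      apply/right_shapeP; rewrite eq_l.
      have := visible (i a).+1; rewrite yf_visible_shape.
      by case: shape_a => -> //=; rewrite ?(negPf yf_a) => /(_ _); lia.
    have yf_l : yf_visible S l by apply: visible; have := ltn_ord l; lia.
    have := cell_visible cell_S (ltn_ord l) (no_zv l lt_l) yf_l.
    rewrite visible; last by have := ltn_ord l; lia.
    by case=> [/left_shapeP|/right_shapeP]; auto.
have lt_zv a p : (p < i a)%N -> (p < n)%N by have := ltn_ord (i a); lia.
have before (a : 'I_k) p :
    a = 0 :> nat -> (p < i a)%N -> edge_shape S p = left_shape.
  by move=> a0 lt_p; apply/(left_shapeP S (Ordinal (lt_zv a p lt_p)))/(cond1 a).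
have between (a b : 'I_k) : b = a.+1 :> nat ->
    (exists m, [/\ (i a < m < i b)%N,
       edge_shape S m = te_shape \/ edge_shape S m = yb_shape,
       forall p, (m < p < i b)%N -> edge_shape S p = left_shape,
       edge_shape S (i a) = right_shape
     & forall p, (i a < p < m)%N ->
         edge_shape S p = left_shape \/ edge_shape S p = right_shape]) \/
    ((edge_shape S (i a) = ze_shape \/ edge_shape S (i a) = te_shape) /\
     forall p, (i a < p < i b)%N -> edge_shape S p = left_shape).
  move=> eq_b; have lt_ab : (i a < i b)%N by apply: i_incr; rewrite eq_b.
  have lt_an := lt_zv _ _ lt_ab.
  have [[m [[[lt_m block_m] _] tail at_a lr]]|[at_a tail]] := cond2 a b eq_b.
    left; exists m; split=> //.
    - by case: block_m => [/te_shapeP|/yb_shapeP]; auto.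
    - move=> p lt_p.
      have lt_pn : (p < n)%N by apply: (lt_zv b); case/andP: lt_p.
      exact/(left_shapeP S (Ordinal lt_pn))/tail.
    - exact/(right_shapeP S (Ordinal lt_an))/at_a.
    move=> p lt_p; have lt_pn : (p < n)%N by have := ltn_ord m; lia.
    by case: (lr (Ordinal lt_pn) lt_p) => [/left_shapeP|/right_shapeP]; auto.
  right; split=> [|p lt_p].
    by case: (at_a (Ordinal lt_an) erefl) => [/ze_shapeP|/te_shapeP]; auto.
  have lt_pn : (p < n)%N by apply: (lt_zv b); case/andP: lt_p.
  exact/(left_shapeP S (Ordinal lt_pn))/tail.
have after (a : 'I_k) : a.+1 = k -> (i a < n)%N ->
    edge_shape S (i a) = right_shape /\
    forall p, (i a < p < n)%N ->
      edge_shape S p = left_shape \/ edge_shape S p = right_shape.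
  move=> eq_k lt_an; have [at_a lr] := cond3 a eq_k lt_an; split.
    exact/(right_shapeP S (Ordinal lt_an))/at_a.
  move=> p /andP[lt_p lt_pn].
  by case: (lr (Ordinal lt_pn) lt_p) => [/left_shapeP|/right_shapeP]; auto.
(* Between two consecutive vertex variables the conditions switch the
   visibility off, at [m] in the first alternative, or never switch it on. *)
have vis a : ~~ yf_visible S (i a).
  move: {2}(nat_of_ord a) (erefl (nat_of_ord a)) => d.
  elim: d a => [|d IH] b eq_b.
    apply: (@left_run_invisible _ S 0 (i b)) => [|p|]; rewrite ?leqnn //.
    exact: before.
  have lt_d : (d < k)%N by have := ltn_ord b; lia.
  have := IH (Ordinal lt_d) erefl; set a := Ordinal lt_d => yf_a.
  have lt_ab : (i a < i b)%N by apply: i_incr; rewrite eq_b.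
  have [[m [lt_m at_m tail _ _]]|[at_a tail]] := between a b eq_b.
    apply: (@left_run_invisible _ S m.+1 (i b)) => //; last by lia.
    by rewrite yf_visible_shape; case: at_m => ->.
  apply: (@left_run_invisible _ S (i a).+1 (i b)) => //; last by lia.
  by rewrite yf_visible_shape; case: at_a => -> //=.
have right_run a r : edge_shape S (i a) = right_shape ->
    (forall p, (i a < p < r)%N ->
      edge_shape S p = left_shape \/ edge_shape S p = right_shape) ->
    forall p, (i a < p <= r)%N -> yf_visible S p.
  move=> at_a lr; apply: left_right_run_visible => //.
  by rewrite yf_visible_shape at_a.
split.
- move=> p lt_p; have [lt_p1|[a le_p]] := segment i hk p.
    apply: cell_left; first exact: (before (Ordinal hk)).
    exact: (no_zv_before i_incr i_Z _ lt_p1).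
  have zv_a := zvm_i i_Z a.
  have [eq_a|ne_a] := eqVneq (nat_of_ord (i a)) p.
    rewrite -{p}eq_a in lt_p le_p *.
    case=> [eq_k|[b eq_b lt_b]].
      by apply: cell_right; [case: (after a eq_k lt_p) | rewrite zv_a].
    have [[m [_ _ _ at_a _]]|[[at_a|at_a] tail]] := between a b eq_b.
    + by apply: cell_right; rewrite ?zv_a.
    + apply: cell_ze => //; apply: left_run_visible tail => //.
      exact: (zvm_i i_Z b).
    by apply: cell_te; rewrite ?zv_a.
  have {ne_a}lt_ap : (i a < p)%N by lia.
  have lr_cell : ~~ zvm S p -> yf_visible S p ->
      edge_shape S p = left_shape \/ edge_shape S p = right_shape -> cell S p.
    move=> no_zv yf_p [at_p|at_p]; first exact: cell_left.
    by apply: cell_right; rewrite ?yf_p ?orbT.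
  case=> [eq_k|[b eq_b lt_b]].
    have lt_an : (i a < n)%N by lia.
    have [at_a lr] := after a eq_k lt_an.
    apply: lr_cell; first exact: (no_zv_after i_incr i_Z eq_k).
      by apply: (right_run a n) => //; lia.
    by apply: lr; lia.
  have no_zv : ~~ zvm S p by apply: (no_zv_between i_incr i_Z eq_b); lia.
  have [[m [lt_m at_m tail at_a lr]]|[_ tail]] := between a b eq_b; last first.
    by apply: cell_left => //; apply: tail; lia.
  have [lt_pm|lt_mp|eq_p] := ltngtP p m.
  + apply: lr_cell => //; last by apply: lr; lia.
    by apply: (right_run a m) => //; lia.
  + by apply: cell_left => //; apply: tail; lia.
  have yf_p : yf_visible S p by apply: (right_run a m) => //; lia.
  rewrite -eq_p in at_m tail; case: at_m => at_p.
    by apply: cell_te; rewrite ?yf_p ?orbT.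
  apply: cell_yb => //; apply: left_run_visible tail => //.
  exact: (zvm_i i_Z b).
- have [lt_n1|[a le_n]] := segment i hk n.
    by have := lt_zv _ _ lt_n1; rewrite ltnn.
  case=> [eq_k|[b _ lt_b]]; last by have := lt_zv _ _ lt_b; rewrite ltnn.
  have [eq_a|ne_a] := eqVneq (nat_of_ord (i a)) n.
    by have := zvm_i i_Z a; rewrite eq_a => ->.
  have lt_an : (i a < n)%N by lia.
  have [at_a lr] := after a eq_k lt_an.
  by rewrite (right_run a n at_a lr n) ?orbT // lt_an leqnn.
by move=> p /(zvmP i_Z)[a ->].
Qed.
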